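(* Let $a\in(0,1/2)$ and $\lambda>0$, and let $\eta$ be distributed according to $\pi^{\lambda,a}_N$. If $\lambda\ge\lambda_c(a)$, then for every $\varepsilon>0$, $$\lim_{N\to\infty}\pi^{\lambda,a}_N\Big(\max_{x\in[0,1]}\Big|\tfrac1N\eta(Nx)-f_{a,\lambda}(x)\Big|\ge\varepsilon\Big)=0,$$ where $f_{a,\lambda}(x)=\max\big(a-d_\lambda x,\ 0,\ a+d_\lambda(x-1)\big)$ and $d_\lambda=1-2/\lambda$. If $\lambda<\lambda_c(a)$, then for every $\varepsilon>0$, $$\lim_{N\to\infty}\pi^{\lambda,a}_N\Big(\max_{x\in[0,1]}\Big|\tfrac1N\eta(Nx)-a\Big|\ge\varepsilon\Big)=0.$$ (Limits along even $N$.)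
   Context: For a real $s$, $\langle s\rangle$ is the smallest even integer $\ge s$. For $N$ even and $a\in(0,1/2)$, $\mathcal S^a_N$ is the set of $\eta=(\eta_x)_{x\in\{0,\dots,N\}}$ with values in $\mathbb Z_{\ge0}$, $\eta_0=\eta_N=\langle aN\rangle$, $|\eta_{x+1}-\eta_x|=1$. $H(\eta)=\#\{x:\eta_x=0\}$, and $\pi^{\lambda,a}_N(\eta)=\lambda^{H(\eta)}/Z^{\lambda,a}_N$ with $Z^{\lambda,a}_N=\sum_{\eta\in\mathcal S^a_N}\lambda^{H(\eta)}$. For non-integer $Nx$, $\eta(Nx)$ denotes the linear interpolation of $\eta$. Let $\textsc{f}(\lambda)=\log\big(\frac{\lambda}{2\sqrt{\lambda-1}}\big)$ for $\lambda>2$, $0$ otherwise. $\lambda_c(a)$ is the unique solution $\lambda$ of $\textsc{f}(\lambda)=a\log(\lambda-1)$.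
   Formalization: The equation F(λ) = a log(λ−1) also has the trivial solution λ = 2, so λ_c(a) is taken to be its solution in (2,∞). *)

(* Defs.v *)
From HB Require Import structures.
From mathcomp Require Import all_boot all_order all_algebra.
From mathcomp Require Import all_classical all_reals all_analysis.
Set Implicit Arguments. Unset Strict Implicit. Unset Printing Implicit Defensive.
Import Order.TTheory GRing.Theory Num.Theory.
Import numFieldNormedType.Exports.
Local Open Scope ring_scope.

Section Defs.
Variable R : realType.

Definition evceil (s : R) : int := 2 * Num.ceil (s / 2).

(* A path eta in S^a_N is encoded by its sequence of N increments
   (true = +1, false = -1) together with its starting height h0. *)
Definition step (b : bool) : int := if b then 1 else -1.

Definition eta_of (h0 : int) (s : seq bool) (x : nat) : int :=
  h0 + \sum_(i < x) step (nth false s i).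

Definition in_S (N : nat) (h0 : int) (s : seq bool) : bool :=
  [forall x : 'I_N.+1, 0 <= eta_of h0 s x] && (eta_of h0 s N == h0).

Definition Hzeros (N : nat) (eta : nat -> int) : nat :=
  #|[set x : 'I_N.+1 | eta x == 0]|.

Definition piN (lam a : R) (N : nat) (E : (nat -> int) -> Prop) : R :=
  let h0 := evceil (a * N%:R) in
  (\sum_(s : N.-tuple bool | in_S N h0 s && `[< E (eta_of h0 s) >])
      lam ^+ Hzeros N (eta_of h0 s))
  / (\sum_(s : N.-tuple bool | in_S N h0 s) lam ^+ Hzeros N (eta_of h0 s)).

Definition interp (eta : nat -> int) (y : R) : R :=
  let k := `|Num.floor y|%N in
  (eta k)%:~R + (y - k%:R) * ((eta k.+1)%:~R - (eta k)%:~R).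

Definition dev_event (g : R -> R) (eps : R) (N : nat) (eta : nat -> int) : Prop :=
  exists x : R, 0 <= x <= 1 /\ eps <= `| interp eta (N%:R * x) / N%:R - g x |.

Definition Fl (lam : R) : R :=
  if 2 < lam then ln (lam / (2 * Num.sqrt (lam - 1))) else 0.

Definition d_lam (lam : R) : R := 1 - 2 / lam.

Definition f_al (a lam : R) (x : R) : R :=
  Num.max (Num.max (a - d_lam lam * x) 0) (a + d_lam lam * (x - 1)).

End Defs.

(* Main.v *)
Require Import Defs.
From HB Require Import structures.
From mathcomp Require Import all_boot all_order all_algebra.
From mathcomp Require Import all_classical all_reals all_analysis.
From mathcomp Require Import zify ring lra.
Import Order.TTheory GRing.Theory Num.Theory.
Import numFieldNormedType.Exports.
Local Open Scope classical_set_scope.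
Local Open Scope ring_scope.

(** For lam > 1 the weight lam^H of a nonnegative bridge of length N = 2n from h > 0 to
    h equals (lam^2/(lam-1))^n times the probability of that path under a Markov chain:
    the walk reflected at 0 whose steps at positive heights are +1 with probability
    1/lam and -1 with probability (lam-1)/lam. Its drift is -d_lam, and it is reversible
    for a measure rho with rho(0) = 1 and rho(h) = lam/(lam-1)^h. Write K (kern) for its
    kernel. Cutting a path at a zero and using reversibility, the paths through 0 have
    total probability of order rho(h): the upper bound is K^n(0,h) = rho(h) K^n(h,0) <=
    rho(h), and for the lower bound two walks from h = aN reach 0 before time N/2,
    because a < d_lam/2 when F(lam) >= a log(lam-1). With h = <aN> this is a multiple of
    2^N exp(N (F(lam) - a log(lam-1))), to be compared with the number of bridges,
    binomial(N, N/2), which is at most 2^N/sqrt(N+1): even at criticality the paths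
    through 0 win, by a factor sqrt(N). The sign of F(lam) - a log(lam-1) is given by
    convexity of F as a function of log(lam-1).

    The shape follows from Chernoff bounds. If the path visits 0 at time k and y at time
    x, reversibility bounds its probability by rho(h) K^x(h,y) K^(N-k)(h,0) or by rho(h)
    K^(N-x)(h,y) K^k(h,0), according to the order of x and k, and one of the two kernels
    is exponentially small unless y is close to N f(x/N). In the unpinned phase the same
    is done with the simple random walk. *)

Set Implicit Arguments.
Unset Strict Implicit.
Unset Printing Implicit Defensive.

(** * Sums over boolean sequences *)

Section BoolSums.
Variable R : realType.
Implicit Types (F G : seq bool -> R) (n : nat).

Fixpoint bsum n F : R :=
  if n is m.+1 then bsum m (fun s => F (true :: s)) + bsum m (fun s => F (false :: s))
  else F [::].

Lemma bsumE n F : \sum_(s : n.-tuple bool) F s = bsum n F.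
Proof.
elim: n F => [|n IH] F /=.
  by rewrite (big_pred1 [tuple]) // => s; rewrite [s]tuple0 /= eqxx.
rewrite -!IH.
rewrite (reindex (fun p : bool * n.-tuple bool => [tuple of p.1 :: p.2])) /=; last first.
  exists (fun t : n.+1.-tuple bool => (thead t, [tuple of behead t])) => [[b s] _|t _] /=.
    by rewrite theadE; congr (_, _); apply: val_inj.
  by apply: val_inj; rewrite [in RHS](tuple_eta t).
rewrite -(pair_big predT predT (fun b (s : n.-tuple bool) => F (b :: s))) /=.
by rewrite big_bool.
Qed.

Lemma eq_bsum n F G : (forall s, size s = n -> F s = G s) -> bsum n F = bsum n G.
Proof. by move=> FG; rewrite -!bsumE; apply: eq_bigr => s _; rewrite FG ?size_tuple. Qed.

Lemma le_bsum n F G : (forall s, size s = n -> F s <= G s) -> bsum n F <= bsum n G.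
Proof. by move=> FG; rewrite -!bsumE; apply: ler_sum => s _; rewrite FG ?size_tuple. Qed.

Lemma bsumD n F G : bsum n (fun s => F s + G s) = bsum n F + bsum n G.
Proof. by rewrite -!bsumE big_split. Qed.

Lemma bsumZ n c F : bsum n (fun s => c * F s) = c * bsum n F.
Proof. by rewrite -!bsumE mulr_sumr. Qed.

Lemma bsum_sum n (I : finType) (F : I -> seq bool -> R) :
  bsum n (fun s => \sum_i F i s) = \sum_i bsum n (F i).
Proof. by rewrite -bsumE exchange_big; apply: eq_bigr => i _; rewrite bsumE. Qed.

Lemma bsum_mkcond n (A : pred (seq bool)) F :
  \sum_(s : n.-tuple bool | A s) F s = bsum n (fun s => (A s)%:R * F s).
Proof.
by rewrite big_mkcond -bsumE; apply: eq_bigr => s _; case: (A s); rewrite ?mul1r ?mul0r.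
Qed.

Lemma bsum_count n k :
  bsum n (fun s => (count id s == k)%:R) = 'C(n, k)%:R.
Proof.
elim: n k => [|n IH] [|k] //=.
  rewrite bin0 -[RHS]add0r; congr (_ + _); last by rewrite -(bin0 n) -IH; apply: eq_bsum => s _.
  rewrite (@eq_bsum _ _ (fun=> 0 * 0)); last by move=> s _; rewrite mul0r.
  by rewrite bsumZ mul0r.
rewrite binS natrD -!IH addrC; congr (_ + _); by apply: eq_bsum => s _.
Qed.

End BoolSums.

Lemma eta_of_cons (h : int) (b : bool) (s : seq bool) (x : nat) :
  eta_of h (b :: s) x.+1 = eta_of (h + step b) s x.
Proof. by rewrite /eta_of big_ord_recl /= addrA. Qed.

Lemma eta_of0 (h : int) (s : seq bool) : eta_of h s 0 = h.
Proof. by rewrite /eta_of big_ord0 addr0. Qed.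

Lemma eta_ofS (h : int) (s : seq bool) (x : nat) :
  eta_of h s x.+1 = eta_of h s x + step (nth false s x).
Proof. by rewrite /eta_of big_ord_recr /= addrA. Qed.

Section Paths.
Implicit Types (h : nat) (s : seq bool).

Definition nxt (h : nat) (b : bool) : nat := if b then h.+1 else h.-1.

Definition ht (h : nat) (s : seq bool) (x : nat) : nat := foldl nxt h (take x s).

Fixpoint nonneg_path (h : nat) (s : seq bool) : bool :=
  if s is b :: s' then (b || (0 < h)%N) && nonneg_path (nxt h b) s' else true.

Lemma ht_cons h b s x : ht h (b :: s) x.+1 = ht (nxt h b) s x.
Proof. by []. Qed.

Lemma ht0 h s : ht h s 0 = h.
Proof. by rewrite /ht take0. Qed.

Lemma htD h s m x : ht h s (m + x) = ht (ht h s m) (drop m s) x.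
Proof. by rewrite /ht takeD foldl_cat. Qed.

Lemma step_nxt h b : b || (0 < h)%N -> Posz h + step b = nxt h b.
Proof. by case: b; case: h => [|h] //= _; rewrite /step /nxt; lia. Qed.

Lemma eta_of_ht h s x : nonneg_path h s -> (x <= size s)%N -> eta_of h s x = ht h s x.
Proof.
elim: s h x => [|b s IH] h [|x] //=; rewrite ?eta_of0 ?ht0 //.
by move=> /andP[hb nn] lex; rewrite eta_of_cons ht_cons step_nxt // IH.
Qed.

Lemma nonneg_pathP h s :
  (forall x, (x <= size s)%N -> 0 <= eta_of h s x) -> nonneg_path h s.
Proof.
elim: s h => [|b s IH] h //= nn.
have hb : b || (0 < h)%N.
  by have := nn 1 isT; rewrite eta_of_cons eta_of0; case: (b) (h) => [] [].
by rewrite hb /=; apply: IH => x lex; rewrite -step_nxt // -eta_of_cons nn.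
Qed.

Lemma in_SE N h s : size s = N -> in_S N h s = nonneg_path h s && (ht h s N == h).
Proof.
move=> sz; apply/andP/andP => [[/forallP nn /eqP e]|[nn /eqP e]].
  have np : nonneg_path h s.
    by apply: nonneg_pathP => x; rewrite sz => lex; have := nn (Ordinal (lex : (x < N.+1)%N)).
  split=> //; apply/eqP; move: e; rewrite eta_of_ht ?sz //.
  by case.
split; last by rewrite eta_of_ht ?sz ?e.
by apply/forallP => x; rewrite eta_of_ht // sz -ltnS.
Qed.

Lemma ht_count h s : nonneg_path h s ->
  (ht h s (size s) + count negb s = h + count id s)%N.
Proof.
elim: s h => [|b s IH] h //= /andP[hb /IH].
by rewrite ht_cons; case: b hb => /=; rewrite /nxt; lia.
Qed.

Lemma ht_le h s x : (ht h s x <= h + x)%N.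
Proof.
elim: s h x => [|b s IH] h [|x]; rewrite ?ht0 ?addn0 // ?ht_cons.
  exact: leq_addr.
by apply: (leq_trans (IH _ _)); case: b => /=; lia.
Qed.

Lemma HzerosE N (eta : nat -> int) : Hzeros N eta = (\sum_(x < N.+1) (eta x == 0))%N.
Proof.
rewrite /Hzeros -sum1_card big_mkcond /=; apply: eq_bigr => x _.
by rewrite inE; case: (_ == _).
Qed.

End Paths.

(** * The reflected walk *)

Section Chain.
Variables (R : realType) (lam : R).
Implicit Types (h n m x y : nat) (s : seq bool) (f g : nat -> R).

Definition jump h (b : bool) : R :=
  if h is _.+1 then (if b then lam^-1 else (lam - 1) / lam) else b%:R.

Fixpoint wt h s : R := if s is b :: s' then jump h b * wt (nxt h b) s' else 1.

Definition transfer f h : R := jump h true * f h.+1 + jump h false * f h.-1.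

Definition kern n h y : R := iter n transfer (fun z => (z == y)%:R) h.

Lemma kernS n h y : kern n.+1 h y = jump h true * kern n h.+1 y + jump h false * kern n h.-1 y.
Proof. by []. Qed.

Lemma bsum_markov m n h y (G : seq bool -> R) :
  bsum (m + n) (fun s => wt h s * (ht h s m == y)%:R * G (drop m s)) =
  kern m h y * bsum n (fun s => wt y s * G s).
Proof.
elim: m h => [|m IH] h.
  rewrite add0n /kern /= -bsumZ; apply: eq_bsum => s _; rewrite ht0 drop0.
  by have [->|_] := eqVneq h y; rewrite ?mulr0 ?mul0r ?mulr1 ?mul1r.
rewrite addSn kernS /= mulrDl.
congr (_ + _); rewrite -mulrA -IH -bsumZ;
  by apply: eq_bsum => s _ /=; rewrite !mulrA.
Qed.

Lemma bsum_wt_end n h y : bsum n (fun s => wt h s * (ht h s n == y)%:R) = kern n h y.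
Proof.
have := bsum_markov n 0 h y (fun=> 1); rewrite addn0 /= !mulr1 => <-.
by apply: eq_bsum => s _; rewrite mulr1.
Qed.

Lemma bsum_wt2 m n h y z :
  bsum (m + n) (fun s => wt h s * (ht h s m == y)%:R * (ht h s (m + n) == z)%:R) =
  kern m h y * kern n y z.
Proof.
rewrite -(bsum_wt_end n) -(bsum_markov m n h y (fun s => (ht y s n == z)%:R)).
apply: eq_bsum => s _; rewrite htD.
by have [->|_] := eqVneq (ht h s m) y; rewrite ?mulr0 ?mul0r.
Qed.

Lemma bsum_wt3 l m n h x y z :
  bsum (l + (m + n)) (fun s => wt h s * (ht h s l == x)%:R * (ht h s (l + m) == y)%:R *
      (ht h s (l + (m + n)) == z)%:R) =
  kern l h x * kern m x y * kern n y z.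
Proof.
rewrite -mulrA -bsum_wt2.
under [bsum (m + n) _]eq_bsum do rewrite -mulrA.
rewrite -(bsum_markov l (m + n) h x
  (fun s => (ht x s m == y)%:R * (ht x s (m + n) == z)%:R)).
apply: eq_bsum => s _; rewrite !htD.
by have [->|_] := eqVneq (ht h s l) x; rewrite ?mulr0 ?mul0r ?mulrA.
Qed.

Hypothesis lam_gt1 : 1 < lam.

Let lam_gt0 : 0 < lam. Proof. exact: lt_trans lam_gt1. Qed.
Let lam_neq0 : lam != 0. Proof. exact: lt0r_neq0. Qed.

Lemma jump_ge0 h b : 0 <= jump h b.
Proof.
case: h => [|h]; first by rewrite /jump ler0n.
by case: b; rewrite /jump ?invr_ge0 ?divr_ge0 ?subr_ge0 ?ltW.
Qed.

Lemma jump_sum h : jump h true + jump h false = 1.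
Proof. by case: h => [|h] /=; [rewrite addr0|field]. Qed.

Lemma wt_ge0 h s : 0 <= wt h s.
Proof. by elim: s h => [|b s IH] h //=; rewrite mulr_ge0 ?jump_ge0. Qed.

Lemma wt_eq0 h s : ~~ nonneg_path h s -> wt h s = 0.
Proof.
elim: s h => [|b s IH] h //=; case: b => /=; first by move=> /IH ->; rewrite mulr0.
by case: h => [|h] /=; rewrite ?mul0r // => /IH ->; rewrite mulr0.
Qed.

Lemma wtE h s : nonneg_path h s ->
  wt h s * lam ^+ size s =
  lam ^+ (\sum_(x < size s) (ht h s x == 0%N))%N * (lam - 1) ^+ count negb s.
Proof.
elim: s h => [|b s IH] h /=; first by rewrite big_ord0 !mulr1.
move=> /andP[hb /IH e]; rewrite big_ord_recl /= ht0 exprS.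
rewrite (_ : _ * _ = jump h b * lam * (wt (nxt h b) s * lam ^+ size s)); last by ring.
rewrite {}e !exprD.
set A := lam ^+ (\sum_(x < _) _)%N.
set B := (lam - 1) ^+ count _ _; clearbody A B.
by case: b hb; case: h => [|h] //= _; rewrite ?expr0 ?expr1; field.
Qed.

Lemma weight_in_S n h s : (0 < h)%N -> size s = n.*2 -> in_S n.*2 h s ->
  lam ^+ Hzeros n.*2 (eta_of h s) = (lam ^+ 2 / (lam - 1)) ^+ n * wt h s.
Proof.
move=> h0 sz; rewrite (in_SE _ sz) => /andP[nn /eqP e].
have cnt : count negb s = n.
  have : (count id s + count negb s = n.*2)%N by rewrite -sz -(count_predC id).
  by have := ht_count nn; rewrite sz e; lia.
rewrite HzerosE big_ord_recr /= eta_of_ht ?sz // e.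
rewrite (_ : (Posz h == 0) = false) ?addn0; last by case: (h) h0.
have /= := wtE nn; rewrite cnt sz => e2.
have -> : (\sum_(x < n.*2) (eta_of h s x == 0) = \sum_(x < n.*2) (ht h s x == 0))%N.
  by apply: eq_bigr => x _; rewrite eta_of_ht // sz ltnW.
have r0 : lam - 1 != 0 by rewrite subr_eq0 gt_eqF.
apply: (mulIf (expf_neq0 n r0)); rewrite -e2 expr_div_n -mulrA [_ * (_ ^+ n)]mulrC.
by rewrite mulrA mulfVK ?expf_neq0 // -exprM mul2n mulrC.
Qed.

End Chain.
Arguments kern : simpl never.

Section Kernel.
Variables (R : realType) (lam : R).
Hypothesis lam_gt1 : 1 < lam.
Implicit Types (h n m x y : nat) (f g : nat -> R).

Local Notation P := (transfer lam).
Local Notation K := (kern lam).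
Local Notation pr := (jump lam).

Let lam_gt0 : 0 < lam. Proof. exact: lt_trans lam_gt1. Qed.
Let lam_neq0 : lam != 0. Proof. exact: lt0r_neq0. Qed.
Let r_gt0 : 0 < lam - 1. Proof. by rewrite subr_gt0. Qed.
Let r_neq0 : lam - 1 != 0. Proof. exact: lt0r_neq0. Qed.

Lemma iter_transfer_le n f g h : (forall z, f z <= g z) -> iter n P f h <= iter n P g h.
Proof.
move=> fg; elim: n h => [|n IH] h //=.
by rewrite /transfer lerD // ler_wpM2l ?jump_ge0.
Qed.

Lemma iter_transfer_lin n c f d g h :
  iter n P (fun z => c * f z + d * g z) h = c * iter n P f h + d * iter n P g h.
Proof. by elim: n h => [|n IH] h //=; rewrite /transfer !IH; ring. Qed.

Lemma iter_transfer_scale n c f h : iter n P (fun z => c * f z) h = c * iter n P f h.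
Proof. by elim: n h => [|n IH] h //=; rewrite /transfer !IH; ring. Qed.

Lemma iter_transfer_cst n c h : iter n P (fun=> c) h = c.
Proof. by elim: n h => [|n IH] h //=; rewrite /transfer !IH -mulrDl jump_sum // mul1r. Qed.

Lemma kern_ge0 n h y : 0 <= K n h y.
Proof. by rewrite -[0](iter_transfer_cst n 0 h); apply: iter_transfer_le => z; rewrite ler0n. Qed.

Lemma kern_le1 n h y : K n h y <= 1.
Proof. by rewrite -[1](iter_transfer_cst n 1 h); apply: iter_transfer_le => z; case: (_ == _). Qed.

Lemma kern_split m n h y z : K m h y * K n y z <= K (m + n) h z.
Proof.
rewrite /kern iterD -/(K m h y) mulrC.
rewrite -iter_transfer_scale; apply: iter_transfer_le => w.
by have [->|_] := eqVneq w y; rewrite ?mulr1 ?mulr0 ?kern_ge0.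
Qed.

Definition rho h : R := if h is _.+1 then lam / (lam - 1) ^+ h else 1.

Lemma rho_gt0 h : 0 < rho h.
Proof. by case: h => [|h] //=; rewrite divr_gt0 // exprn_gt0. Qed.

Lemma rhoE h : (0 < h)%N -> rho h = lam / (lam - 1) ^+ h.
Proof. by case: h. Qed.

Lemma transfer_delta h z : P (fun z => (z == h)%:R) z =
  rho h * pr h true / rho h.+1 * (z == h.+1)%:R + rho h * pr h false / rho h.-1 * (z == h.-1)%:R.
Proof.
rewrite /transfer; case: z => [|[|z]]; case: h => [|[|h]];
  rewrite /= ?eqSS /= ?exprS ?expr0; do ?case: (_ == _);
  by field; rewrite ?r_neq0 ?lam_neq0 ?expf_neq0.
Qed.

Lemma detailed_balance n h y : rho h * K n h y = rho y * K n y h.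
Proof.
elim: n h => [|n IH] h.
  by rewrite /kern /= eq_sym; have [->|] := eqVneq y h; rewrite ?mulr0.
rewrite {2}/kern iterSr.
rewrite (_ : P _ = (fun z => rho h * pr h true / rho h.+1 * (z == h.+1)%:R +
  rho h * pr h false / rho h.-1 * (z == h.-1)%:R)); last exact/funext/transfer_delta.
have ry := lt0r_neq0 (rho_gt0 y).
have e b : K n y b = rho b * K n b y / rho y by rewrite IH mulrC mulKf.
rewrite iter_transfer_lin -[iter n P _ y]/(K n y h.+1) -[iter n P _ y]/(K n y h.-1) !e kernS.
have g1 := lt0r_neq0 (rho_gt0 h.+1); have g2 := lt0r_neq0 (rho_gt0 h.-1).
by field; rewrite g1 g2 ry.
Qed.

Lemma kern0_rho n h : K n 0 h = rho h * K n h 0.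
Proof. by rewrite -detailed_balance mul1r. Qed.

Lemma expR_le_quad (t : R) : t <= 1 / 2 -> expR t <= 1 + t + 2 * t ^+ 2.
Proof.
move=> t2; have := expR_ge1Dx (- t); rewrite expRN => e.
have t1 : 0 < 1 - t by lra.
have : expR t <= (1 - t)^-1.
  by rewrite -[expR t]invrK lef_pV2 ?posrE ?invr_gt0 ?expR_gt0.
move=> /le_trans; apply; rewrite -div1r ler_pdivrMr //; nra.
Qed.

Lemma one_step_mgf (t : R) : `|t| <= 1 / 2 ->
  lam^-1 * expR t + (lam - 1) / lam * expR (- t) <= expR (- (d_lam lam * t) + 2 * t ^+ 2).
Proof.
rewrite ler_norml => /andP[t1 t2].
apply: le_trans (expR_ge1Dx _).
have e1 := expR_le_quad t2; have e2 : expR (- t) <= 1 + (- t) + 2 * (- t) ^+ 2.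
  by apply: expR_le_quad; lra.
have p0 : 0 <= lam^-1 by rewrite invr_ge0 ltW.
have q0 : 0 <= (lam - 1) / lam by apply: divr_ge0; apply: ltW.
apply: le_trans (lerD (ler_wpM2l p0 e1) (ler_wpM2l q0 e2)) _.
by rewrite le_eqVlt; apply/orP; left; apply/eqP; rewrite /d_lam; field.
Qed.

Lemma mgf_up (t m : R) n h : 0 <= t -> t <= 1 / 2 ->
  m = expR (- (d_lam lam * t) + 2 * t ^+ 2) -> m < 1 ->
  iter n P (fun z => expR (t * z%:R)) h <= expR (t * h%:R) * m ^+ n + expR t / (1 - m).
Proof.
move=> t0 t2 mE m_lt1.
have m1 : 0 < 1 - m by rewrite subr_gt0.
have m0 : 0 <= m by rewrite mE expR_ge0.
have C0 : 0 <= expR t / (1 - m) by rewrite divr_ge0 ?expR_ge0 // ltW.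
elim: n h => [|n IH] h; first by rewrite expr0 mulr1 lerDl.
rewrite iterSr.
have step z : P (fun z => expR (t * z%:R)) z <= m * expR (t * z%:R) + expR t * 1.
  rewrite /transfer; case: z => [|z] /=.
    by rewrite mulr1 mul1r mul0r addr0 mulr1 lerDr mulr_ge0 ?expR_ge0.
  apply: (@le_trans _ _ (m * expR (t * z.+1%:R))); last by rewrite lerDl mulr1 expR_ge0.
  have -> : t * z.+2%:R = t + t * z.+1%:R by rewrite -[z.+2]add1n natrD; ring.
  have -> : t * z%:R = - t + t * z.+1%:R by rewrite -[z.+1]add1n natrD; ring.
  rewrite !expRD !mulrA -mulrDl ler_wpM2r ?expR_ge0 //.
  by rewrite mE; apply: one_step_mgf; rewrite ger0_norm.
apply: le_trans (iter_transfer_le n h step) _; rewrite iter_transfer_lin iter_transfer_cst mulr1.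
apply: le_trans (lerD (ler_wpM2l m0 (IH h)) (lexx _)) _.
rewrite le_eqVlt exprS; apply/orP; left; apply/eqP; field.
exact: lt0r_neq0.
Qed.

Lemma mgf_down (t : R) n h : 0 <= t -> t <= 1 / 2 -> 0 <= d_lam lam ->
  iter n P (fun z => expR (- t * z%:R)) h <=
  expR (- t * h%:R) * expR (d_lam lam * t + 2 * t ^+ 2) ^+ n.
Proof.
move=> t0 t2 d0; set m := expR (_ + _).
have m1 : 1 <= m by rewrite -[1]expR0 ler_expR addr_ge0 ?mulr_ge0 ?exprn_ge0.
elim: n h => [|n IH] h; first by rewrite expr0 mulr1.
rewrite iterSr.
have step z : P (fun z => expR (- t * z%:R)) z <= m * expR (- t * z%:R).
  rewrite /transfer; case: z => [|z] /=.
    rewrite mulr1 mul1r mul0r addr0 mulr0 expR0 mulr1; apply: le_trans m1.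
    by rewrite expR_le1 oppr_le0.
  have -> : - t * z.+2%:R = - t + - t * z.+1%:R by rewrite -[z.+2]add1n natrD; ring.
  have -> : - t * z%:R = - (- t) + - t * z.+1%:R by rewrite -[z.+1]add1n natrD; ring.
  rewrite !expRD !mulrA -mulrDl ler_wpM2r ?expR_ge0 //.
  have := @one_step_mgf (- t); rewrite normrN ger0_norm // => /(_ t2) /le_trans; apply.
  by rewrite mulrN opprK sqrrN.
apply: le_trans (iter_transfer_le n h step) _; rewrite iter_transfer_scale.
by rewrite exprS mulrCA ler_wpM2l ?expR_ge0.
Qed.

Lemma kern_chernoff (t : R) n h y :
  K n h y <= expR (- (t * y%:R)) * iter n P (fun z => expR (t * z%:R)) h.
Proof.
rewrite -iter_transfer_scale; apply: iter_transfer_le => z.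
have [->|_] := eqVneq z y; first by rewrite -expRD addNr expR0.
by rewrite mulr_ge0 ?expR_ge0.
Qed.

Lemma kern_down_ge n y : (y <= n)%N -> odd n = odd y -> ((lam - 1) / lam) ^+ n <= K n y 0.
Proof.
have q0 : 0 <= (lam - 1) / lam by apply: divr_ge0; apply: ltW.
have q1 : (lam - 1) / lam <= 1 by rewrite ler_pdivrMr // mul1r gerBl ler01.
elim: n y => [|n IH] [|y] //= le_yn par.
- have n0 : (0 < n)%N by case: (n) par.
  rewrite kernS /= mul1r mul0r addr0 exprS.
  apply: (@le_trans _ _ (((lam - 1) / lam) ^+ n)); first by rewrite ler_piMl ?exprn_ge0.
  by apply: IH => //; rewrite -[odd n]negbK par.
- rewrite kernS /= exprS; apply: ler_wpDl; first by rewrite mulr_ge0 ?kern_ge0 // invr_ge0 ltW.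
  by rewrite ler_wpM2l //; apply: IH => //; apply: negb_inj.
Qed.

Lemma iter_transfer_even n h : iter n P (fun z => (~~ odd z)%:R) h = (~~ odd (h + n))%:R :> R.
Proof.
elim: n h => [|n IH] h /=; first by rewrite addn0.
have /= e := jump_sum lam_gt1 1.
rewrite /transfer !IH !addnS; case: h => [|h] /=; first by rewrite mul0r addr0 mul1r.
by rewrite !negbK -mulrDl e mul1r.
Qed.

Lemma kern_return_ge (t : R) B m h : 0 < t -> ~~ odd B -> ~~ odd (h + m) ->
  ((lam - 1) / lam) ^+ B *
    (1 - expR (- (t * B%:R)) * iter m P (fun z => expR (t * z%:R)) h) <= K (m + B) h 0.
Proof.
move=> t0 evB evh; set q := (lam - 1) / lam.
have q0 : 0 <= q by apply: divr_ge0; apply: ltW.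
have e : 1 = iter m P (fun z => (~~ odd z)%:R) h by rewrite iter_transfer_even evh.
rewrite mulrBr {1}e mulrA -mulNr -iter_transfer_lin /kern iterD.
apply: iter_transfer_le => z; rewrite -/(K B z 0) mulNr -mulrA -expRD -mulrBr.
have [zB|Bz] := leqP z B.
  have [oz|ez] := boolP (odd z).
    apply: le_trans (kern_ge0 _ _ _); rewrite mulr_ge0_le0 ?exprn_ge0 //.
    by rewrite sub0r oppr_le0 expR_ge0.
  apply: (@le_trans _ _ (q ^+ B)); first by rewrite ler_piMr ?exprn_ge0 // gerBl expR_ge0.
  by apply: kern_down_ge; rewrite // (negbTE evB) (negbTE ez).
apply: le_trans (kern_ge0 _ _ _); rewrite mulr_ge0_le0 ?exprn_ge0 // subr_le0.
apply: (@le_trans _ _ 1); first by case: (~~ _).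
rewrite ltW // expR_gt1 addrC -mulrBr mulr_gt0 ?subr_gt0 ?ltr_nat //.
Qed.

End Kernel.

(** * The free energy *)

Section FreeEnergy.
Variable R : realType.
Implicit Types a x y lam lamc : R.

Lemma ln_lt_sub1 x : 0 < x -> x != 1 -> ln x < x - 1.
Proof.
move=> x0 x1; have := @expR_gt1Dx R (ln x); rewrite lnK ?posrE // ln_eq0 // => /(_ x1).
by rewrite ltrBrDl.
Qed.

(* Strict concavity of ln at y / x = (1 - 1/x) (y-1)/(x-1) + 1/x; in the variable
   ln (lam - 1) it is the strict convexity of the free energy. *)
Lemma ln_tangent x y : 1 < x -> 1 < y -> x != y ->
  (1 - x^-1) * (ln (y - 1) - ln (x - 1)) < ln y - ln x.
Proof.
move=> x1 y1 xy.
have x0 : 0 < x by lra. have y0 : 0 < y by lra.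
have xm : 0 < x - 1 by lra. have ym : 0 < y - 1 by lra.
have u0 : 0 < ((y - 1) * x) / ((x - 1) * y) by rewrite divr_gt0 ?mulr_gt0.
have u1 : ((y - 1) * x) / ((x - 1) * y) != 1.
  apply/eqP => /(congr1 (fun z => z * ((x - 1) * y))).
  rewrite mulfVK ?mulf_neq0 ?lt0r_neq0 // mul1r => e.
  by move/eqP: xy; apply; lra.
have v0 : 0 < x / y by rewrite divr_gt0.
have v1 : x / y != 1.
  by apply: contra xy => /eqP e; apply/eqP; rewrite -[RHS]mul1r -e mulfVK ?lt0r_neq0.
have := ln_lt_sub1 u0 u1; have := ln_lt_sub1 v0 v1.
rewrite !ln_div ?posrE ?mulr_gt0 // !lnM ?posrE //.
set A := ln (y - 1); set B := ln (x - 1); set C := ln x; set D := ln y => h1 h2.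
have p0 : 0 < x^-1 by rewrite invr_gt0.
have q0 : 0 < 1 - x^-1 by rewrite subr_gt0 invf_lt1.
have k1 : x^-1 * (C - D) < x^-1 * (x / y - 1) by rewrite ltr_pM2l.
have k2 : (1 - x^-1) * (A + C - (B + D)) < (1 - x^-1) * ((y - 1) * x / ((x - 1) * y) - 1).
  by rewrite ltr_pM2l.
have e : x^-1 * (x / y - 1) + (1 - x^-1) * ((y - 1) * x / ((x - 1) * y) - 1) = 0.
  by field; rewrite ?lt0r_neq0.
have := ltrD k1 k2; rewrite e.
have -> : x^-1 * (C - D) + (1 - x^-1) * (A + C - (B + D)) =
  (1 - x^-1) * (A - B) - (D - C) by ring.
by rewrite subr_lt0.
Qed.

Lemma FlE lam : 2 < lam -> Fl lam = ln lam - ln 2 - ln (lam - 1) / 2.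
Proof.
move=> l2; rewrite /Fl l2.
have l0 : 0 < lam by lra. have lm : 0 < lam - 1 by lra.
have s0 : 0 < Num.sqrt (lam - 1) by rewrite sqrtr_gt0.
rewrite ln_div ?posrE ?mulr_gt0 // lnM ?posrE //.
have : ln (Num.sqrt (lam - 1) ^+ 2) = ln (lam - 1) by rewrite sqr_sqrtr // ltW.
by rewrite lnXn // mulr2n => <-; lra.
Qed.

Lemma expR_Fl lam : 2 < lam -> expR (2 * Fl lam) = lam ^+ 2 / (4 * (lam - 1)).
Proof.
move=> l2; rewrite /Fl l2.
have l0 : 0 < lam by lra. have lm : 0 < lam - 1 by lra.
have s0 : 0 < Num.sqrt (lam - 1) by rewrite sqrtr_gt0.
rewrite expRM_natl lnK ?posrE ?divr_gt0 ?mulr_gt0 //.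
by rewrite expr_div_n exprMn sqr_sqrtr ?ltW // -natrX.
Qed.

Lemma Fl_tangent lam lam' : 2 < lam -> 2 < lam' -> lam != lam' ->
  Fl lam + (1 / 2 - lam^-1) * (ln (lam' - 1) - ln (lam - 1)) < Fl lam'.
Proof.
move=> l2 l2' ne; rewrite !FlE //.
have := @ln_tangent lam lam'; have -> : 1 < lam by lra. have -> : 1 < lam' by lra.
by move=> /(_ isT isT ne); lra.
Qed.

Lemma Fl_lt_slope lam : 2 < lam -> Fl lam < (1 / 2 - lam^-1) * ln (lam - 1).
Proof.
move=> l2; rewrite FlE //.
have := @ln_tangent lam 2; have -> : 1 < lam by lra. have -> : 1 < 2 :> R by lra.
have -> : lam != 2 by rewrite gt_eqF.
move=> /(_ isT isT isT); have -> : 2 - 1 = 1 :> R by lra.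
by rewrite ln1; lra.
Qed.

Lemma slope_gt a lam : 2 < lam -> a * ln (lam - 1) <= Fl lam -> a < d_lam lam / 2.
Proof.
move=> l2 /le_lt_trans/(_ (Fl_lt_slope l2)).
have l0 : 0 < ln (lam - 1) by rewrite ln_gt0; lra.
by rewrite ltr_pM2r // => h; rewrite /d_lam; lra.
Qed.

Lemma Fl_supercritical a lam lamc : 2 < lamc -> Fl lamc = a * ln (lamc - 1) ->
  lamc <= lam -> a * ln (lam - 1) <= Fl lam.
Proof.
move=> c2 ec; rewrite le_eqVlt => /predU1P[<-|lt]; first by rewrite ec.
have l2 : 2 < lam by lra.
have sl : a < 1 / 2 - lamc^-1.
  by have := @slope_gt a lamc c2; rewrite ec lexx => /(_ isT); rewrite /d_lam; lra.
have := Fl_tangent c2 l2 (negbT (lt_eqF lt)); rewrite ec => h.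
have l0 : 0 <= ln (lam - 1) - ln (lamc - 1).
  by rewrite subr_ge0 ler_ln ?posrE; lra.
have := ler_wpM2r l0 (ltW sl); lra.
Qed.

Lemma Fl_subcritical a lam lamc : 2 < lam -> Fl lamc = a * ln (lamc - 1) ->
  lam < lamc -> Fl lam < a * ln (lam - 1).
Proof.
move=> l2 ec lt; rewrite ltNge; apply/negP => h.
have c2 : 2 < lamc by lra.
have := slope_gt l2 h; rewrite /d_lam => sl.
have := Fl_tangent l2 c2 (negbT (lt_eqF lt)); rewrite ec => h2.
have l0 : 0 <= ln (lamc - 1) - ln (lam - 1).
  by rewrite subr_ge0 ler_ln ?posrE; lra.
have sl' : a <= 1 / 2 - lam^-1 by lra.
have := ler_wpM2r l0 sl'; lra.
Qed.

End FreeEnergy.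

Section Asymptotics.
Variable R : realType.

Lemma poly_mul_exp_le k (c : R) : 0 < c -> exists2 C : R, 0 < C &
  forall n : nat, n.+1%:R ^+ k * expR (- (c * n%:R)) <= C / n.+1%:R.
Proof.
move=> c0; exists (k.+1`!%:R * expR c / c ^+ k.+1).
  by rewrite divr_gt0 ?mulr_gt0 ?expR_gt0 ?exprn_gt0 // ltr0n fact_gt0.
move=> n; have n0 : 0 < n.+1%:R :> R by rewrite ltr0n.
have f0 : 0 < k.+1`!%:R :> R by rewrite ltr0n fact_gt0.
have c0' : 0 < c ^+ k.+1 by rewrite exprn_gt0.
have e := @expR_ge1Dxn R _ k (mulr_ge0 (ltW c0) (ltW n0)).
have {}e : (c * n.+1%:R) ^+ k.+1 <= k.+1`!%:R * expR (c * n.+1%:R).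
  rewrite [leRHS]mulrC -ler_pdivrMr //; apply: le_trans e.
  by rewrite lerDr.
rewrite ler_pdivlMr // mulrAC -exprSr expRN ler_pdivrMr ?expR_gt0 //.
rewrite mulrAC ler_pdivlMr // mulrC -exprMn -mulrA -expRD.
by apply: (le_trans e); rewrite -[n.+1]add1n natrD mulrDr mulr1.
Qed.

Lemma central_binS n : (n.+1 * 'C(n.+1.*2, n.+1) = 2 * n.*2.+1 * 'C(n.*2, n))%N.
Proof.
have h1 := mul_bin_diag n.*2.+2 n; have h2 := mul_bin_down n.*2.+1 n.
rewrite doubleS; move: h1 h2; rewrite /=.
have -> : (n.*2.+1 - n = n.+1)%N by lia.
by nia.
Qed.

Lemma central_bin_ge n : (4 ^ n <= n.*2.+1 * 'C(n.*2, n))%N.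
Proof.
elim: n => [|n IH] //; rewrite -(leq_pmul2l (ltn0Sn n)) mulnCA central_binS expnS.
move: IH; set A := (4 ^ n)%N; set B := 'C(_, _); rewrite doubleS; nia.
Qed.

Lemma central_bin_le n : (n.*2.+1 * 'C(n.*2, n) ^ 2 <= (4 ^ n) ^ 2)%N.
Proof.
elim: n => [|n IH] //.
rewrite -(leq_pmul2l (_ : 0 < n.+1 ^ 2)%N) // mulnCA -expnMn central_binS [(4 ^ n.+1)%N]expnS !expnMn.
move: IH; set A := ((4 ^ n) ^ 2)%N; set B := ('C(_, _) ^ 2)%N; rewrite doubleS -!mul2n => IH.
have : (2 ^ 2 * (2 * n.+1).+1 * (2 * n).+1 * ((2 * n).+1 * B) <=
        2 ^ 2 * (2 * n.+1).+1 * (2 * n).+1 * A)%N by rewrite leq_mul2l IH orbT.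
nia.
Qed.

Lemma free_mgf (t : R) n h x : `|t| <= 1 / 2 -> (x <= n)%N ->
  bsum n (fun s => expR (t * (eta_of h s x)%:~R)) <=
  2 ^+ n * (expR (t * h%:~R) * expR (2 * t ^+ 2) ^+ x).
Proof.
move=> t2.
elim: n h x => [|n IH] h [|x] //=; rewrite ?eta_of0 ?mul1r ?mulr1 ?expr0 ?mulr1 //.
  move=> _; rewrite (@eq_bsum _ _ _ (fun s => expR (t * (eta_of h s 0)%:~R))); last first.
    by move=> s _; rewrite !eta_of0.
  rewrite [X in _ + X](@eq_bsum _ _ _ (fun s => expR (t * (eta_of h s 0)%:~R))); last first.
    by move=> s _; rewrite !eta_of0.
  have := IH h 0%N isT; rewrite expr0 mulr1 exprS -mulrA => e.
  by rewrite mulr_natl mulr2n lerD.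
move=> lexn.
rewrite (@eq_bsum _ _ _ (fun s => expR (t * (eta_of (h + 1) s x)%:~R))); last first.
  by move=> s _; rewrite eta_of_cons.
rewrite [X in _ + X](@eq_bsum _ _ _ (fun s => expR (t * (eta_of (h - 1) s x)%:~R))); last first.
  by move=> s _; rewrite eta_of_cons.
apply: le_trans (lerD (IH _ _ lexn) (IH _ _ lexn)) _.
set E := expR (2 * t ^+ 2) ^+ x; set X := expR (t * h%:~R).
have -> : 2 ^+ n * (expR (t * (h + 1)%:~R) * E) + 2 ^+ n * (expR (t * (h - 1)%:~R) * E) =
    2 ^+ n * X * E * (expR t + expR (- t)).
  rewrite !rmorphD rmorphN !rmorph1 !mulrDr mulrN mulr1 !expRD /X /=; ring.
have -> : 2 ^+ n.+1 * (X * expR (2 * t ^+ 2) ^+ x.+1) =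
    2 ^+ n * X * E * (2 * expR (2 * t ^+ 2)) by rewrite [2 ^+ n.+1]exprS [_ ^+ x.+1]exprS -/E; ring.
apply: ler_wpM2l; first by rewrite !mulr_ge0 ?exprn_ge0 ?expR_ge0.
move: t2; rewrite ler_norml => /andP[t1 t2].
have e1 := expR_le_quad t2; have e2 : expR (- t) <= 1 + (- t) + 2 * (- t) ^+ 2.
  by apply: expR_le_quad; lra.
have := expR_ge1Dx (2 * t ^+ 2); lra.
Qed.

Lemma free_deviation (t u : R) n (h : int) x : 0 <= t -> t <= 1 / 2 -> (x <= n)%N ->
  bsum n (fun s => (u <= `|(eta_of h s x)%:~R - h%:~R|)%R%:R) <=
  2 * 2 ^+ n * expR (- (t * u) + 2 * t ^+ 2 * n%:R).
Proof.
move=> t0 t2 lexn.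
have p := @free_mgf t n h x; have m := @free_mgf (- t) n h x.
rewrite normrN ger0_norm // in p m; have {}p := p t2 lexn; have {}m := m t2 lexn.
have e1 : 1 <= expR (2 * t ^+ 2) by rewrite -[X in X <= _]expR0 ler_expR mulr_ge0 ?exprn_ge0.
have ex : expR (2 * t ^+ 2) ^+ x <= expR (2 * t ^+ 2) ^+ n by rewrite ler_weXn2l.
rewrite sqrrN in m.
have A : bsum n (fun s => expR (- (t * u) - t * h%:~R) * expR (t * (eta_of h s x)%:~R)) <=
    2 ^+ n * expR (- (t * u) + 2 * t ^+ 2 * n%:R).
  rewrite bsumZ; apply: le_trans (ler_wpM2l (expR_ge0 _) p) _.
  rewrite mulrCA ler_wpM2l ?exprn_ge0 // mulrA -expRD subrK expRD ler_wpM2l ?expR_ge0 //.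
  by rewrite expRM_natr.
have B : bsum n (fun s => expR (- (t * u) + t * h%:~R) * expR (- t * (eta_of h s x)%:~R)) <=
    2 ^+ n * expR (- (t * u) + 2 * t ^+ 2 * n%:R).
  rewrite bsumZ; apply: le_trans (ler_wpM2l (expR_ge0 _) m) _.
  rewrite mulrCA ler_wpM2l ?exprn_ge0 // mulrA -expRD mulNr addrK expRD ler_wpM2l ?expR_ge0 //.
  by rewrite expRM_natr.
rewrite mulr_natl mulr2n mulrDl; apply: le_trans (lerD A B); rewrite -bsumD.
apply: le_bsum => s _; rewrite -!expRD.
have [dev|_] := boolP (u <= _); last by rewrite addr_ge0 ?expR_ge0.
move: dev; rewrite ler_normr => /orP[] dev.
  apply: ler_wpDr; rewrite ?expR_ge0 //= -[X in X <= _]expR0 ler_expR; have := ler_wpM2l t0 dev; lra.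
apply: ler_wpDl; rewrite ?expR_ge0 //= -[X in X <= _]expR0 ler_expR; have := ler_wpM2l t0 dev; lra.
Qed.

End Asymptotics.

(** * Paths and weights *)

Section Discretization.
Variable R : realType.
Implicit Types (a lam : R) (N : nat).

Lemma evceil_nat a N : 0 <= a -> exists h : nat,
  [/\ evceil (a * N%:R) = h, ~~ odd h, a * N%:R <= h%:R & h%:R <= a * N%:R + 2].
Proof.
move=> a0; rewrite /evceil; set y := a * N%:R.
have y0 : 0 <= y by rewrite mulr_ge0.
have := ceil_itv (y / 2).
have : 0 <= Num.ceil (y / 2) by rewrite ceil_ge0; lra.
case: (Num.ceil (y / 2)) => // k _; rewrite intrB -!pmulrn => /andP[k1 k2].
exists (k.*2); split; first by rewrite -mul2n PoszM.
- by rewrite odd_double.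
- by rewrite -mul2n natrM; lra.
- by rewrite -mul2n natrM; lra.
Qed.

Lemma dist_max (u v u' v' e : R) :
  `|u - u'| <= e -> `|v - v'| <= e -> `|Num.max u v - Num.max u' v'| <= e.
Proof.
rewrite !ler_norml => /andP[h1 h2] /andP[h3 h4].
by case: (leP u v) => ?; case: (leP u' v') => ?; apply/andP; split; lra.
Qed.

Lemma f_al_lipschitz a lam x y : 2 <= lam -> `|f_al a lam x - f_al a lam y| <= `|x - y|.
Proof.
move=> l2; have l0 : 0 < lam by lra.
have d0 : 0 <= d_lam lam by rewrite /d_lam subr_ge0 ler_pdivrMr //; lra.
have d1 : d_lam lam <= 1 by rewrite /d_lam gerBl divr_ge0 //; lra.
have k z : `|d_lam lam * z| <= `|z|.
  by rewrite normrM ger0_norm // ler_piMl.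
apply: dist_max; first apply: dist_max.
- rewrite (_ : _ - _ = d_lam lam * (y - x)); last by ring.
  by rewrite [leRHS]distrC.
- by rewrite subrr normr0.
- rewrite (_ : _ - _ = d_lam lam * (x - y)) //; by ring.
Qed.

Lemma dev_event_grid (g : R -> R) eps N (eta : nat -> int) :
  (forall x y, `|g x - g y| <= `|x - y|) -> (forall k, `|eta k.+1 - eta k| <= 1) ->
  (0 < N)%N -> dev_event g eps N eta ->
  exists k : 'I_N.+1, eps * N%:R - 2 <= `|(eta k)%:~R - N%:R * g (k%:R / N%:R)|.
Proof.
move=> gL etaL N0 [x [/andP[x0 x1] dev]].
have N0' : 0 < N%:R :> R by rewrite ltr0n.
move: dev; rewrite /interp.
have y0 : 0 <= N%:R * x by rewrite mulr_ge0.
have := floor_itv (N%:R * x).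
have : 0 <= Num.floor (N%:R * x) by rewrite floor_ge0.
case: (Num.floor (N%:R * x)) => // k _; rewrite absz_nat intrD -!pmulrn => /andP[k1 k2] dev.
have kN : (k < N.+1)%N.
  by rewrite ltnS -(@ler_nat R); apply: le_trans k1 _; rewrite ler_piMr.
exists (Ordinal kN) => /=.
set A := (eta k)%:~R in dev *; set g0 := g (k%:R / N%:R).
set D := (N%:R * x - k%:R) * _ in dev.
have D1 : `|D| <= 1.
  rewrite /D normrM mulr_ile1 ?normr_ge0 //.
    by rewrite ger0_norm; lra.
  by rewrite -intrB -intr_norm -[X in _ <= X]/(1%:~R) ler_int.
have G1 : `|N%:R * g x - N%:R * g0| <= 1.
  rewrite -mulrBr normrM [`|N%:R|]ger0_norm //.
  apply: le_trans (ler_wpM2l (ltW N0') (gL _ _)) _.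
  rewrite -{1}[N%:R]ger0_norm // -normrM mulrBr mulrCA divff ?lt0r_neq0 // mulr1.
  by rewrite ger0_norm; lra.
have : eps * N%:R <= `|A + D - N%:R * g x|.
  rewrite (_ : A + D - _ = ((A + D) / N%:R - g x) * N%:R); last first.
    by rewrite mulrBl mulfVK ?lt0r_neq0 // [g x * _]mulrC.
  by rewrite normrM [`|N%:R|]ger0_norm ?ler_pM2r // ltW.
have : `|A + D - N%:R * g x| <= `|A - N%:R * g0| + `|D| + `|N%:R * g x - N%:R * g0|.
  rewrite (_ : A + D - N%:R * g x = (A - N%:R * g0) + D - (N%:R * g x - N%:R * g0)); last by ring.
  by apply: le_trans (ler_normB _ _) _; rewrite lerD2r ler_normD.
lra.
Qed.

Lemma f_al_scaled a lam N (k : nat) : (0 < N)%N ->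
  N%:R * f_al a lam (k%:R / N%:R) =
  Num.max (Num.max (a * N%:R - d_lam lam * k%:R) 0) (a * N%:R + d_lam lam * (k%:R - N%:R)).
Proof.
move=> N0; have N0' : 0 < N%:R :> R by rewrite ltr0n.
rewrite /f_al !maxr_pMr ?ltW // mulr0; congr (Num.max (Num.max _ _) _).
  by field; rewrite lt0r_neq0.
by field; rewrite lt0r_neq0.
Qed.

End Discretization.

Section PathSums.
Variables (R : realType).
Implicit Types (lam : R) (h n : nat) (s : seq bool).

Definition touches N h s : bool := [exists k : 'I_N.+1, eta_of h s k == 0].

Lemma eta_of_size (z : int) s :
  eta_of z s (size s) = z + (count id s)%:Z - (count negb s)%:Z.
Proof.
elim: s z => [|b s IH] z; first by rewrite eta_of0 /=; lia.
by rewrite /= eta_of_cons IH; case: b; rewrite /step /=; lia.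
Qed.

Lemma bridge_count (z : int) s n : size s = n.*2 ->
  (eta_of z s n.*2 == z) = (count id s == n).
Proof.
move=> sz; have := eta_of_size z s; rewrite sz => ->.
have : (count id s + count negb s = n.*2)%N by rewrite -sz -(count_predC id).
by move=> e; apply/eqP/eqP; lia.
Qed.

Lemma untouched_Hzeros N h s : ~~ touches N h s -> Hzeros N (eta_of h s) = 0%N.
Proof.
move=> /existsPn nt; rewrite HzerosE big1 // => x _.
by rewrite (negbTE (nt x)).
Qed.

Lemma untouched_weight_le lam h n :
  \sum_(s : n.*2.-tuple bool | in_S n.*2 h s && ~~ touches n.*2 h s)
     lam ^+ Hzeros n.*2 (eta_of h s) <= 'C(n.*2, n)%:R.
Proof.
rewrite (@bsum_mkcond _ _ (fun s => in_S n.*2 h s && ~~ touches n.*2 h s)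
  (fun s => lam ^+ Hzeros n.*2 (eta_of h s))) -bsum_count.
apply: le_bsum => s sz; have [/andP[]|_] := boolP (_ && _); last by rewrite mul0r ler0n.
move=> /andP[_]; rewrite bridge_count // => -> /untouched_Hzeros ->.
by rewrite mul1r.
Qed.

Lemma partition_ge lam h n : 1 < lam -> (0 < h)%N ->
  (lam ^+ 2 / (lam - 1)) ^+ n * kern lam n.*2 h h <=
  \sum_(s : n.*2.-tuple bool | in_S n.*2 h s) lam ^+ Hzeros n.*2 (eta_of h s).
Proof.
move=> l1 h0; rewrite (@bsum_mkcond _ _ (in_S n.*2 h) (fun s => lam ^+ Hzeros n.*2 (eta_of h s))).
rewrite -bsum_wt_end -bsumZ; apply: le_bsum => s sz.
have [inS|] := boolP (in_S n.*2 h s).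
  rewrite mul1r (weight_in_S l1 h0 sz inS) ler_wpM2l ?exprn_ge0 //.
    by rewrite divr_ge0 ?exprn_ge0 //; lra.
  by rewrite ler_piMr ?wt_ge0 //; case: (_ == _).
rewrite (in_SE _ sz) negb_and mul0r => /orP[/wt_eq0 ->|/negbTE ->]; first by rewrite !mul0r mulr0.
by rewrite !mulr0.
Qed.

Lemma touch_position_weight lam h N k x y : 1 < lam -> (k <= N)%N -> (x <= N)%N ->
  exists2 w : R, 0 <= w <= 1 &
  exists n1 n2, [/\ n1 = x \/ n1 = (N - x)%N, (n1 <= N)%N, (n2 <= N - n1)%N &
  bsum N (fun s => wt lam h s * (ht h s k == 0%N)%:R * (ht h s x == y)%:R * (ht h s N == h)%:R) =
  rho lam h * (kern lam n1 h y * kern lam n2 h 0) * w].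
Proof.
move=> l1 kN xN; have [kx|xk] := leqP k x.
  exists (kern lam (x - k) y 0); first by rewrite kern_ge0 ?kern_le1.
  exists (N - x)%N, k; split; [by right|exact: leq_subr|by rewrite subKn|].
  have := bsum_wt3 lam k (x - k) (N - x) h 0 y h.
  have -> : (k + (x - k + (N - x)) = N)%N by lia.
  rewrite subnKC // => ->.
  rewrite kern0_rho // -[LHS]mulrA -[X in _ * X]mulrA [X in _ * (_ * X)]mulrC [X in _ * X]mulrA.
  rewrite detailed_balance //; ring.
exists (kern lam (k - x) y 0); first by rewrite kern_ge0 ?kern_le1.
exists x, (N - k)%N; split; [by left|by []|by lia|].
have := bsum_wt3 lam x (k - x) (N - k) h y 0 h.
have -> : (x + (k - x + (N - k)) = N)%N by lia.
rewrite subnKC ?(ltnW xk) // kern0_rho // => e.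
rewrite (_ : rho lam h * _ * _ = kern lam x h y * kern lam (k - x) y 0 *
  (rho lam h * kern lam (N - k) h 0)); last by ring.
by rewrite -e; apply: eq_bsum => s _; congr (_ * _); rewrite mulrAC.
Qed.

Lemma touched_weight_le lam h n (bad : nat -> nat -> bool) (eps : R) :
  1 < lam -> (0 < h)%N -> 0 <= eps ->
  (forall x y n2, (x <= n.*2)%N -> (n2 <= n.*2 - x)%N -> bad x y ->
     kern lam x h y * kern lam n2 h 0 <= eps) ->
  (forall x y, (x <= n.*2)%N -> bad x y -> bad (n.*2 - x)%N y) ->
  \sum_(s : n.*2.-tuple bool | in_S n.*2 h s && touches n.*2 h s &&
        [exists x : 'I_n.*2.+1, bad x `|eta_of h s x|%N])
     lam ^+ Hzeros n.*2 (eta_of h s) <=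
  (lam ^+ 2 / (lam - 1)) ^+ n *
    ((n.*2.+1 * n.*2.+1 * (h + n.*2).+1)%:R * (rho lam h * eps)).
Proof.
move=> l1 h0 eps0 small sym; set N := n.*2; set L := (lam ^+ 2 / (lam - 1)) ^+ n.
have L0 : 0 <= L by rewrite exprn_ge0 // divr_ge0 ?exprn_ge0 //; lra.
rewrite (@bsum_mkcond _ _ (fun s => in_S N h s && touches N h s &&
        [exists x : 'I_N.+1, bad x `|eta_of h s x|%N]) (fun s => lam ^+ Hzeros N (eta_of h s))).
pose T := ('I_N.+1 * 'I_N.+1 * 'I_(h + N).+1)%type.
pose F (p : T) s := (bad p.1.2 p.2)%:R * (wt lam h s * (ht h s p.1.1 == 0%N)%:R *
  (ht h s p.1.2 == p.2)%:R * (ht h s N == h)%:R).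
have F0 p s : 0 <= F p s by rewrite /F !mulr_ge0 ?ler0n ?wt_ge0.
apply: (@le_trans _ _ (bsum N (fun s => L * \sum_(p : T) F p s))).
  apply: le_bsum => s sz.
  have [/andP[/andP[inS /existsP[k /eqP k0]] /existsP[x bx]]|_] := boolP (_ && _); last first.
    by rewrite mul0r mulr_ge0 ?sumr_ge0.
  rewrite mul1r (weight_in_S l1 h0 sz inS) ler_wpM2l //.
  move: inS; rewrite (in_SE _ sz) => /andP[nn /eqP e].
  have kN : (k <= size s)%N by rewrite sz -ltnS.
  have xN : (x <= size s)%N by rewrite sz -ltnS.
  move: k0 bx; rewrite !eta_of_ht //= => -[k0] bx.
  have yb : (ht h s x < (h + N).+1)%N.
    by rewrite ltnS (leq_trans (ht_le _ _ _)) // leq_add2l -ltnS.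
  rewrite (bigD1 (k, x, Ordinal yb)) //= {1}/F /= bx k0 !eqxx e eqxx !mulr1 mul1r.
  by rewrite lerDl sumr_ge0.
rewrite bsumZ ler_wpM2l // bsum_sum.
have -> : (N.+1 * N.+1 * (h + N).+1 = #|{: T}|)%N by rewrite !card_prod !card_ord.
rewrite mulr_natl -sumr_const; apply: ler_sum => -[[k x] y] _ /=.
have rho0 := ltW (rho_gt0 l1 h).
rewrite bsumZ /=; have [b|_] := boolP (bad x y); last by rewrite mul0r mulr_ge0.
rewrite mul1r.
have [w /andP[w0 w1] [n1 [n2 [n1x n1N n2N ->]]]] :=
  @touch_position_weight lam h N k x y l1 (ltn_ord k) (ltn_ord x).
have b1 : bad n1 y by case: n1x => -> //; apply: sym => //; rewrite -ltnS.
have k0 : 0 <= kern lam n1 h y * kern lam n2 h 0 by rewrite mulr_ge0 ?kern_ge0.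
rewrite -mulrA ler_wpM2l //; apply: le_trans (small _ _ _ n1N n2N b1).
by rewrite ler_piMr.
Qed.

End PathSums.

(** * Concentration of the reflected walk *)

Section Localization.
Variables (R : realType) (lam : R).
Hypothesis lam_gt2 : 2 < lam.
Local Notation d := (d_lam lam).
Local Notation K := (kern lam).

Let lam_gt1 : 1 < lam. Proof. by move: lam_gt2; lra. Qed.
Let lam_gt0 : 0 < lam. Proof. by move: lam_gt2; lra. Qed.

Lemma d_lam_gt0 : 0 < d.
Proof. by rewrite /d_lam subr_gt0 ltr_pdivrMr // mul1r. Qed.

Lemma drift_lt1 (t : R) : 0 < t -> 4 * t <= d -> expR (- (d * t) + 2 * t ^+ 2) < 1.
Proof.
move=> t0 td; rewrite expR_lt1.
by have := ler_wpM2l (ltW t0) td; have := mulr_gt0 t0 t0; nra.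
Qed.

Lemma kern_le_up (t : R) n h y : 0 < t -> t <= 1 / 2 -> 4 * t <= d ->
  K n h y <= expR (- (t * y%:R) + t * h%:R + (- (d * t) + 2 * t ^+ 2) * n%:R) +
    expR t / (1 - expR (- (d * t) + 2 * t ^+ 2)) * expR (- (t * y%:R)).
Proof.
move=> t0 t2 td.
have up := mgf_up lam_gt1 n h (ltW t0) t2 erefl (drift_lt1 t0 td).
apply: le_trans (kern_chernoff lam_gt1 t n h y) _.
apply: le_trans (ler_wpM2l (expR_ge0 _) up) _.
by rewrite mulrDr [X in _ + X]mulrC -expRM_natr -!expRD addrA.
Qed.

Lemma kern_le_down (t : R) n h y : 0 < t -> t <= 1 / 2 ->
  K n h y <= expR (t * y%:R - t * h%:R + (d * t + 2 * t ^+ 2) * n%:R).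
Proof.
move=> t0 t2.
have down := mgf_down lam_gt1 n h (ltW t0) t2 (ltW d_lam_gt0).
apply: le_trans (kern_chernoff lam_gt1 (- t) n h y) _.
apply: le_trans (ler_wpM2l (expR_ge0 _) down) _.
by rewrite -expRM_natr -!expRD mulNr opprK mulNr addrA.
Qed.

Lemma kern_deviation (a delta t : R) N h x y n2 :
  0 < t -> t <= 1 / 2 -> 4 * t <= delta -> 4 * t <= d -> (0 < N)%N ->
  a * N%:R <= h%:R -> h%:R <= a * N%:R + 2 -> (x <= N)%N -> (n2 <= N - x)%N ->
  delta * N%:R <= `|y%:R - Num.max (Num.max (a * N%:R - d * x%:R) 0) (a * N%:R + d * (x%:R - N%:R))| ->
  K x h y * K n2 h 0 <=
  (expR 1 + expR t / (1 - expR (- (d * t) + 2 * t ^+ 2))) * expR (- (t * delta * N%:R / 2)).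
Proof.
move=> t0 t2 tdel td N0 h1 h2 xN n2N dev.
set C := expR t / _; set e := expR (- (_ / 2)).
have C0 : 0 <= C by rewrite divr_ge0 ?expR_ge0 // subr_ge0 ltW // drift_lt1.
have e1 : 1 <= expR 1 :> R by rewrite -[X in X <= _]expR0 ler_expR.
have e0 : 0 <= e by rewrite expR_ge0.
have N1 : 0 < N%:R :> R by rewrite ltr0n.
have x0 : 0 <= x%:R :> R by [].
have xN' : x%:R <= N%:R :> R by rewrite ler_nat.
have y0 : 0 <= y%:R :> R by [].
have n20 : 0 <= n2%:R :> R by [].
have n2N' : n2%:R <= N%:R - x%:R :> R by rewrite -natrB // ler_nat.
have d0 := d_lam_gt0.
have tN : 4 * t * (t * N%:R) <= delta * (t * N%:R) by rewrite ler_wpM2r // ltW // mulr_gt0.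
have tt : 0 < t * t by rewrite mulr_gt0.
have ttx : t * t * x%:R <= t * t * N%:R by rewrite ler_wpM2l // ltW.
have th1 : t * (a * N%:R) <= t * h%:R by rewrite ler_wpM2l // ltW.
have th2 : t * h%:R <= t * (a * N%:R + 2) by rewrite ler_wpM2l // ltW.
have weak z : z <= e -> z <= (expR 1 + C) * e.
  move=> /le_trans; apply; rewrite ler_peMl //; apply: le_trans e1 _; by rewrite lerDl.
set F := Num.max _ _ in dev.
have [F1 F2 F3] : [/\ a * N%:R - d * x%:R <= F, 0 <= F & a * N%:R + d * (x%:R - N%:R) <= F].
  by rewrite /F !le_max !lexx !orbT.
move: dev; rewrite ler_normr => /orP[up|down].
  apply: (@le_trans _ _ (K x h y)); first by rewrite ler_piMr ?kern_ge0 ?kern_le1.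
  apply: le_trans (kern_le_up _ _ _ t0 t2 td) _; rewrite [leRHS]mulrDl; apply: lerD.
    rewrite -expRD ler_expR.
    have ty : t * (delta * N%:R + (a * N%:R - d * x%:R)) <= t * y%:R by rewrite ler_wpM2l //; lra.
    lra.
  rewrite ler_wpM2l // ler_expR.
  have ty : t * (delta * N%:R) <= t * y%:R by rewrite ler_wpM2l //; lra.
  have := mulr_gt0 t0 (mulr_gt0 t0 N1); lra.
apply: weak.
have delN : 0 < delta * N%:R by rewrite mulr_gt0 //; lra.
have [Fcase|Fcase] : F = a * N%:R - d * x%:R \/ F = a * N%:R + d * (x%:R - N%:R).
  have [c1|c1] := leP (Num.max (a * N%:R - d * x%:R) 0) (a * N%:R + d * (x%:R - N%:R)).
    by right; rewrite /F max_r.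
  have {c1}FE : F = Num.max (a * N%:R - d * x%:R) 0 by rewrite /F max_l // ltW.
  have [c2|c2] := leP (a * N%:R - d * x%:R) 0; last by left; rewrite FE max_l // ltW.
  by move: FE; rewrite max_r // => FE; move: down; rewrite FE subr0; lra.
- apply: (@le_trans _ _ (K x h y)); first by rewrite ler_piMr ?kern_ge0 ?kern_le1.
  apply: le_trans (kern_le_down _ _ _ t0 t2) _; rewrite ler_expR.
  have ty : t * y%:R <= t * (a * N%:R - d * x%:R - delta * N%:R) by rewrite ler_wpM2l //; lra.
  lra.
- apply: (@le_trans _ _ (K n2 h 0)); first by rewrite ler_piMl ?kern_ge0 ?kern_le1.
  apply: le_trans (kern_le_down _ _ _ t0 t2) _; rewrite ler_expR mulr0 add0r.
  have dn2 : d * t * n2%:R <= d * t * (N%:R - x%:R) by rewrite ler_wpM2l // mulr_ge0 // ltW.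
  have ty : t * (delta * N%:R) <= t * (a * N%:R + d * (x%:R - N%:R)) by rewrite ler_wpM2l //; lra.
  have ttn : t * t * n2%:R <= t * t * N%:R by rewrite ler_wpM2l //; lra.
  lra.
Qed.

Lemma ex_nat_ge (z : R) : exists n : nat, z <= n%:R.
Proof.
exists (Num.bound `|z|); apply: le_trans (ler_norm z) (ltW _); exact: archi_boundP.
Qed.

Lemma kern_return (a : R) : 0 <= a -> a < d / 2 -> exists2 c : R, 0 < c &
  exists n0, forall n h m, (n0 <= n)%N -> ~~ odd h -> ~~ odd m ->
    h%:R <= a * n.*2%:R + 2 -> (n <= m.+1)%N -> c <= K m h 0.
Proof.
move=> a0 ad.
have d0 := d_lam_gt0.
pose t := Num.min (1 / 2) ((d - 2 * a) / 4).
have t0 : 0 < t by rewrite lt_min; apply/andP; split; lra.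
have t2 : t <= 1 / 2 by rewrite ge_min lexx.
have ta : 4 * t <= d - 2 * a.
  have : t <= (d - 2 * a) / 4 by rewrite ge_min lexx orbT.
  lra.
have td : 4 * t <= d by lra.
have mu1 := drift_lt1 t0 td.
set mu := expR _ in mu1; set C := expR t / (1 - mu).
have C0 : 0 < C by rewrite divr_gt0 ?expR_gt0 // subr_gt0.
have [j hj] := ex_nat_ge (4 * C / t).
pose B := j.*2.
have hB : expR (- (t * B%:R)) * C <= 1 / 4.
  rewrite expRN mulrC ler_pdivrMr ?expR_gt0 //.
  have := expR_ge1Dx (t * B%:R).
  move: hj; rewrite ler_pdivrMr // /B -addnn natrD => hj.
  have := mulr_ge0 (ler0n R j) (ltW t0); lra.
pose kap := t * (d - 2 * a) / 2.
have kap0 : 0 < kap by rewrite divr_gt0 // mulr_gt0 //; lra.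
pose c0 := 2 * t + d * t * (1 + B%:R).
have [D D0 hD] := poly_mul_exp_le 0 kap0.
have [k hk] := ex_nat_ge (4 * D * expR c0).
pose q := (lam - 1) / lam.
have q0 : 0 < q by rewrite divr_gt0 // subr_gt0.
exists (q ^+ B / 2); first by rewrite divr_gt0 // exprn_gt0.
exists (k + B.+1)%N => n h m n0n evh evm hn nm.
have Bm : (B <= m)%N.
  by rewrite -ltnS; apply: leq_trans nm; apply: leq_trans n0n; exact: leq_addl.
rewrite -(subnK Bm); have /= := @kern_return_ge R lam lam_gt1 t B (m - B) h t0.
rewrite /B odd_double oddD (negbTE evh) oddB // odd_double (negbTE evm) -/B.
move=> /(_ isT isT); apply: le_trans.
rewrite -/q ler_pM2l ?exprn_gt0 //.
have up := mgf_up lam_gt1 (m - B) h (ltW t0) t2 erefl mu1.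
have {up} := ler_wpM2l (expR_ge0 (- (t * B%:R))) up; rewrite -/mu -/C mulrDr.
suff : expR (- (t * B%:R)) * (expR (t * h%:R) * mu ^+ (m - B)) <= 1 / 4 by lra.
apply: (@le_trans _ _ (expR c0 * expR (- (kap * n%:R)))).
  rewrite -expRM_natr -!expRD ler_expR.
  have mn : n%:R <= (m - B)%:R + 1 + B%:R :> R by rewrite natr1 -natrD ler_nat addSn subnK.
  move: hn; rewrite -addnn natrD => hn.
  have th : t * h%:R <= t * (a * (n%:R + n%:R) + 2) by rewrite ler_wpM2l // ltW.
  have tB : 0 <= t * B%:R by rewrite mulr_ge0 // ltW.
  have dt : 0 <= d * t - 2 * t ^+ 2.
    by have := ler_wpM2l (ltW t0) td; have := mulr_gt0 t0 t0; nra.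
  have dm := ler_wpM2l dt mn.
  have tt : t * n%:R * (4 * t) <= t * n%:R * (d - 2 * a) by rewrite ler_wpM2l // mulr_ge0 // ltW.
  have t2B : 0 <= t * t * (1 + B%:R) by rewrite !mulr_ge0 ?addr_ge0 // ltW.
  rewrite /c0 /kap; lra.
have := hD n; rewrite expr0 mul1r ler_pdivlMr ?ltr0n // => hDn.
have nk : 4 * D * expR c0 <= n.+1%:R.
  by apply: le_trans hk _; rewrite ler_nat (leq_trans _ (leqW n0n)) // leq_addr.
have n1 : 0 < n.+1%:R :> R by rewrite ltr0n.
rewrite -(ler_pM2r n1) -mulrA.
apply: le_trans (ler_wpM2l (expR_ge0 c0) hDn) _; lra.
Qed.

Lemma growthE n h : (0 < h)%N ->
  (lam ^+ 2 / (lam - 1)) ^+ n * rho lam h =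
  4 ^+ n * (lam * expR (2 * Fl lam * n%:R - ln (lam - 1) * h%:R)).
Proof.
move=> h0; have r0 : 0 < lam - 1 by rewrite subr_gt0.
have -> : lam ^+ 2 / (lam - 1) = 4 * expR (2 * Fl lam).
  by rewrite expR_Fl //; field; rewrite lt0r_neq0.
rewrite exprMn -expRM_natr -[LHS]mulrA; congr (4 ^+ n * _).
by rewrite rhoE // expRD expRN expRM_natr [expR (_ * h%:R)]expRM_natr lnK ?posrE //; ring.
Qed.

Lemma growth_ge (a : R) n h : a * ln (lam - 1) <= Fl lam -> (0 < h)%N ->
  h%:R <= a * n.*2%:R + 2 ->
  4 ^+ n * (lam * expR (- (2 * ln (lam - 1)))) <= (lam ^+ 2 / (lam - 1)) ^+ n * rho lam h.
Proof.
move=> aF h0 hn; rewrite growthE // ler_pM2l ?exprn_gt0 // ler_pM2l // ler_expR.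
have l0 : 0 <= ln (lam - 1) by apply: ln_ge0; move: lam_gt2; lra.
move: hn; rewrite -addnn natrD => hn.
have := ler_wpM2l l0 hn; have := ler_wpM2r (ler0n R n) aF; lra.
Qed.

Lemma growth_le (a : R) n h : (0 < h)%N -> a * n.*2%:R <= h%:R ->
  (lam ^+ 2 / (lam - 1)) ^+ n * rho lam h <=
  4 ^+ n * (lam * expR (- (2 * (a * ln (lam - 1) - Fl lam) * n%:R))).
Proof.
move=> h0 hn; rewrite growthE // ler_pM2l ?exprn_gt0 // ler_pM2l // ler_expR.
have l0 : 0 <= ln (lam - 1) by apply: ln_ge0; move: lam_gt2; lra.
move: hn; rewrite -addnn natrD => hn.
have := ler_wpM2l l0 hn; lra.
Qed.

End Localization.

Section Limits.
Variable R : realType.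

Lemma cvg0_of_bound (u : nat -> R) (A B : R) n0 :
  (forall n, (n0 <= n)%N -> 0 <= u n <= A / n.+1%:R + B * Num.sqrt (n.+1%:R^-1)) ->
  u @ \oo --> (0 : R).
Proof.
move=> bnd.
apply: (@squeeze_cvgr _ _ _ _ (fun=> 0) (fun n => A * harmonic n + B * Num.sqrt (harmonic n))).
- by near=> n; apply: bnd; near: n; exists n0.
- exact: cvg_cst.
- rewrite (_ : 0 = A * 0 + B * Num.sqrt 0); last by rewrite sqrtr0 !mulr0 addr0.
  have cs : Num.sqrt (@harmonic R n) @[n --> \oo] --> Num.sqrt (0 : R).
    by apply: (cvg_comp _ _ (@cvg_harmonic R)); exact: sqrt_continuous.
  exact: (cvgD (cvgM (cvg_cst A) (@cvg_harmonic R)) (cvgM (cvg_cst B) cs)).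
Unshelve. all: by end_near. Qed.

Lemma central_bin_ratio n : 'C(n.*2, n)%:R <= 4 ^+ n * Num.sqrt (n.+1%:R^-1) :> R.
Proof.
have n0 : 0 < n.+1%:R :> R by rewrite ltr0n.
rewrite -(@ler_pXn2r _ 2) ?nnegrE ?mulr_ge0 ?exprn_ge0 ?sqrtr_ge0 //.
rewrite exprMn sqr_sqrtr ?invr_ge0 ?ler0n // ler_pdivlMr // -!natrX -natrM ler_nat.
apply: leq_trans (central_bin_le n); rewrite mulnC leq_mul2r; apply/orP; right; lia.
Qed.

End Limits.

(** * The two phases *)

Section PhaseTransition.
Variable R : realType.
Implicit Types (a lam eps : R) (n h : nat).

Lemma sum_le_cover (I : finType) (A B C : pred I) (w : I -> R) :
  (forall i, 0 <= w i) -> (forall i, A i -> B i || C i) ->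
  \sum_(i | A i) w i <= \sum_(i | B i) w i + \sum_(i | C i) w i.
Proof.
move=> w0 ABC; rewrite !(big_mkcond A, big_mkcond B, big_mkcond C) -big_split /=.
apply: ler_sum => i _; have := ABC i; have := w0 i.
case: (A i); case: (B i); case: (C i) => //= wi; rewrite ?addr0 ?add0r //;
  by [rewrite lerDl|move=> /(_ isT)|rewrite addr_ge0].
Qed.

Lemma large_index (n0 k n : nat) : (n0 + k + 1 <= n)%N ->
  [/\ (n0 <= n)%N, (k <= n)%N, (0 < n)%N & (k <= n.*2)%N].
Proof. by move=> ?; split; lia. Qed.

Lemma even_halves n : [/\ (n./2.*2 <= n.*2)%N, (n <= n./2.*2.+1)%N &
  (n <= (n.*2 - n./2.*2).+1)%N].
Proof. by split; lia. Qed.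

Lemma eta_of_lipschitz (z : int) s k : `|eta_of z s k.+1 - eta_of z s k| <= 1.
Proof. by rewrite eta_ofS addrC addKr; case: (nth _ _ _). Qed.

Lemma cube_count_le n h : h%:R <= n%:R + 2 :> R ->
  (n.*2.+1 * n.*2.+1 * (h + n.*2).+1)%:R <= 12 * n.+1%:R ^+ 3 :> R.
Proof.
rewrite -natrD ler_nat => hn; rewrite -natrX -natrM ler_nat.
have -> : (12 * n.+1 ^ 3 = n.+1.*2 * n.+1.*2 * (3 * n.+1))%N by rewrite -!mul2n; nia.
by rewrite !leq_mul //; lia.
Qed.

Lemma in_S_ge0 N (z : int) s (x : 'I_N.+1) : in_S N z s -> 0 <= eta_of z s x.
Proof. by move=> /andP[/forallP]. Qed.

Lemma supercritical a lam eps : 0 < a -> a < 1 / 2 -> 2 < lam ->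
  a * ln (lam - 1) <= Fl lam -> 0 < eps ->
  (fun n : nat => piN lam a n.*2 (dev_event (f_al a lam) eps n.*2)) @ \oo --> (0 : R).
Proof.
move=> a0 a2 l2 aF eps0.
have l1 : 1 < lam by lra. have l0 : 0 < lam by lra.
have d0 := d_lam_gt0 l2.
have [c c0 [n0 ret]] := kern_return l2 (ltW a0) (slope_gt l2 aF).
pose delta := eps / 2.
pose t := Num.min (1 / 2) (Num.min (delta / 4) (d_lam lam / 4)).
have t0 : 0 < t by rewrite !lt_min; apply/and3P; split; rewrite /delta; lra.
have t2 : t <= 1 / 2 by rewrite ge_min lexx.
have tdel : 4 * t <= delta.
  have : t <= delta / 4 by rewrite !ge_min lexx !orbT.
  lra.
have td : 4 * t <= d_lam lam.
  have : t <= d_lam lam / 4 by rewrite !ge_min lexx !orbT.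
  lra.
pose C1 := expR 1 + expR t / (1 - expR (- (d_lam lam * t) + 2 * t ^+ 2)).
have C10 : 0 <= C1.
  by rewrite addr_ge0 ?expR_ge0 // divr_ge0 ?expR_ge0 // subr_ge0 ltW // drift_lt1.
have tdelta0 : 0 < t * delta by rewrite mulr_gt0 // /delta; lra.
have [D D0 hD] := poly_mul_exp_le 3 tdelta0.
pose kap := lam * expR (- (2 * ln (lam - 1))).
have kap0 : 0 < kap by rewrite mulr_gt0 ?expR_gt0.
have [k hk] := ex_nat_ge (4 / eps).
apply: (@cvg0_of_bound _ _ (12 * C1 * D / (c * c)) (kap * (c * c))^-1 (n0 + k + 1)).
move=> n nbig.
have [n0n _ n1 kN] := large_index nbig.
have N0 : (0 < n.*2)%N by rewrite double_gt0.
have N0' : 0 < n.*2%:R :> R by rewrite ltr0n.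
have [h [hE evh h1 h2]] := @evceil_nat R a n.*2 (ltW a0).
have h0 : (0 < h)%N by rewrite -(ltr0n R); apply: lt_le_trans h1; rewrite mulr_gt0.
rewrite /piN hE; set N := n.*2 in N0 N0' h1 h2 *.
set w := fun s : N.-tuple bool => lam ^+ Hzeros N (eta_of h s).
have w0 s : 0 <= w s by rewrite exprn_ge0 // ltW.
set num := (X in X / _); set Z := (X in _ / X).
pose F x := Num.max (Num.max (a * N%:R - d_lam lam * x%:R) 0) (a * N%:R + d_lam lam * (x%:R - N%:R)).
pose bad x y := (delta * N%:R <= `|y%:R - F x|)%R.
pose L := (lam ^+ 2 / (lam - 1)) ^+ n.
have rho0 := rho_gt0 l1 h.
have L0 : 0 < L by rewrite exprn_gt0 // divr_gt0 ?exprn_gt0 // subr_gt0.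
have bad_sym x y : (x <= N)%N -> bad x y -> bad (N - x)%N y.
  move=> xN; rewrite /bad (_ : F (N - x)%N = F x) // /F natrB //.
  rewrite (_ : _ - _ * (_ - _) = a * N%:R + d_lam lam * (x%:R - N%:R)); last by ring.
  rewrite (_ : _ + _ * (_ - _ - _) = a * N%:R - d_lam lam * x%:R); last by ring.
  by rewrite maxAC [X in Num.max X 0]maxC maxAC.
pose E := C1 * expR (- (t * delta * N%:R / 2)).
have E0 : 0 <= E by rewrite mulr_ge0 ?expR_ge0.
have small x y n2 : (x <= N)%N -> (n2 <= N - x)%N -> bad x y ->
    kern lam x h y * kern lam n2 h 0 <= E.
  by move=> xN n2N; apply: kern_deviation.
have touched := touched_weight_le l1 h0 E0 small bad_sym.
have untouched := untouched_weight_le lam h n.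
have num_le : num <= L * ((N.+1 * N.+1 * (h + N).+1)%:R * (rho lam h * E)) + 'C(N, n)%:R.
  apply: le_trans (lerD touched untouched); apply: sum_le_cover => // s /andP[inS /asboolP dev].
  rewrite inS /=; case: (touches _ _ _) => //=; rewrite orbF.
  have [] // := dev_event_grid _ _ N0 dev.
  - by move=> x y; apply: f_al_lipschitz; exact: ltW.
  - by move=> j; exact: eta_of_lipschitz.
  move=> x; rewrite f_al_scaled // => devx; apply/existsP; exists x; rewrite /bad.
  have ex := gez0_abs (in_S_ge0 x inS).
  have -> : `|eta_of h s x|%N%:R = (eta_of h s x)%:~R :> R by rewrite -[in RHS]ex.
  apply: le_trans devx.
  have : 4 / eps <= N%:R by apply: le_trans hk _; rewrite ler_nat.
  by rewrite ler_pdivrMr // /delta; lra.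
have Z_ge : L * (rho lam h * (c * c)) <= Z.
  apply: le_trans (partition_ge n l1 h0); rewrite ler_pM2l //.
  have [hm hm1 hm2] := even_halves n.
  have := kern_split l1 n./2.*2 (N - n./2.*2) h 0 h; rewrite subnKC // => /(le_trans _); apply.
  rewrite kern0_rho // [leRHS]mulrCA ler_pM2l //.
  apply: ler_pM; rewrite ?(ltW c0) //; apply: (ret n) => //; rewrite ?odd_double //.
  by rewrite oddB // !odd_double.
have num0 : 0 <= num by apply: sumr_ge0 => s _; exact: w0.
have Q0 : 0 < L * (rho lam h * (c * c)) by rewrite !mulr_gt0.
have Z0 : 0 < Z by apply: lt_le_trans Z_ge.
apply/andP; split; first by rewrite divr_ge0 // ltW.
set S := Num.sqrt _; have S0 : 0 <= S by rewrite sqrtr_ge0.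
apply: (@le_trans _ _ (num / (L * (rho lam h * (c * c))))).
  by rewrite ler_wpM2l // lef_pV2 ?posrE.
rewrite ler_pdivrMr // mulrDl; apply: le_trans num_le _; apply: lerD.
  have h3 : h%:R <= n%:R + 2 :> R.
    move: h2; rewrite /N -addnn natrD => h2.
    have := ler_wpM2r (ler0n R n) (ltW a2); lra.
  rewrite (_ : 12 * C1 * D / (c * c) / n.+1%:R * _ =
      L * (12 * (rho lam h * (C1 * (D / n.+1%:R))))); last first.
    by move: (n.+1%:R^-1) => V; field; rewrite lt0r_neq0.
  rewrite ler_pM2l // mulrCA [leRHS]mulrCA ler_pM2l // /E mulrCA [leRHS]mulrCA ler_wpM2l //.
  apply: (@le_trans _ _ (12 * n.+1%:R ^+ 3 * expR (- (t * delta * N%:R / 2)))).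
    by rewrite ler_wpM2r ?expR_ge0 // cube_count_le.
  rewrite -mulrA ler_wpM2l //; have := hD n; congr (_ * expR (- _) <= _).
  by rewrite /N -addnn natrD; field.
have gr := growth_ge l2 aF h0 h2; rewrite -/kap -/L in gr.
apply: le_trans (central_bin_ratio R n) _; rewrite -/S.
rewrite (_ : _^-1 * S * _ = L * rho lam h * (S / kap)); last by field; rewrite !lt0r_neq0.
rewrite mulrA ler_pdivlMr // mulrAC ler_wpM2r //.
Qed.

Lemma free_any_deviation (t u : R) (n h : nat) : 0 < t -> t <= 1 / 2 -> 4 * t <= u ->
  bsum n.*2 (fun s => [exists x : 'I_n.*2.+1,
      (u * n.*2%:R <= `|(eta_of h s x)%:~R - h%:R|)%R]%:R) <=
  4 ^+ n * (4 * (n.+1%:R * expR (- (t * u * n%:R)))).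
Proof.
move=> t0 t2 tu.
apply: (@le_trans _ _ (bsum n.*2 (fun s => \sum_(x < n.*2.+1)
    (u * n.*2%:R <= `|(eta_of h s x)%:~R - h%:R|)%R%:R))).
  apply: le_bsum => s _; case: existsP => [[x dx]|_]; last by rewrite sumr_ge0.
  by rewrite (bigD1 x) //= dx lerDl sumr_ge0.
rewrite bsum_sum.
apply: (@le_trans _ _ (\sum_(x < n.*2.+1) 2 * 4 ^+ n * expR (- (t * u * n%:R)))).
  apply: ler_sum => x _.
  have xn : (x <= n.*2)%N by rewrite -ltnS.
  have := @free_deviation R t (u * n.*2%:R) n.*2 h x (ltW t0) t2 xn.
  move=> /le_trans; apply.
  rewrite -mul2n exprM -natrX -[(2 ^ 2)%N]/4%N ler_pM2l ?mulr_gt0 ?exprn_gt0 // ler_expR natrM.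
  have := ler_wpM2r (ler0n R n) (ler_wpM2l (ltW t0) tu); lra.
rewrite sumr_const card_ord -[leLHS]mulr_natl.
rewrite [leRHS](_ : _ = 2 * n.+1%:R * (2 * 4 ^+ n * expR (- (t * u * n%:R)))); last by ring.
rewrite ler_wpM2r ?mulr_ge0 ?expR_ge0 ?exprn_ge0 // -natrM ler_nat mul2n doubleS ltnW //.
Qed.

Lemma subcritical_partition_ge a lam (n h : nat) (u : R) : 0 < lam -> (0 < n)%N -> u <= a ->
  a * n.*2%:R <= h%:R ->
  'C(n.*2, n)%:R - bsum n.*2 (fun s => [exists x : 'I_n.*2.+1,
      (u * n.*2%:R <= `|(eta_of h s x)%:~R - h%:R|)%R]%:R) <=
  \sum_(s : n.*2.-tuple bool | in_S n.*2 h s) lam ^+ Hzeros n.*2 (eta_of h s).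
Proof.
move=> l0 n0 ua ah.
rewrite (@bsum_mkcond _ _ (in_S n.*2 h) (fun s => lam ^+ Hzeros n.*2 (eta_of h s))).
rewrite lerBlDr -bsum_count -bsumD; apply: le_bsum => s sz.
have w0 : 0 <= lam ^+ Hzeros n.*2 (eta_of h s) by rewrite exprn_ge0 // ltW.
case: existsP => [_|nd].
  by apply: ler_wpDl; [rewrite mulr_ge0|case: (_ == _)].
rewrite addr0 -(bridge_count h sz); have [br|_] := eqVneq; last by rewrite mulr_ge0.
have pos (x : 'I_n.*2.+1) : 0 < eta_of h s x.
  rewrite -(ltr0z R) ltNge; apply/negP => neg; apply: nd; exists x.
  have uN : u * n.*2%:R <= a * n.*2%:R by rewrite ler_wpM2r.
  by rewrite ler_normr; apply/orP; right; lra.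
have nt : ~~ touches n.*2 h s by apply/existsPn => x; rewrite gt_eqF.
rewrite untouched_Hzeros // expr0 mulr1.
rewrite (_ : in_S _ _ _ = true) //; apply/andP; split; last by rewrite br.
by apply/forallP => x; exact: ltW.
Qed.

Lemma subcritical a lam lamc eps : 0 < a -> a < 1 / 2 -> 0 < lam -> 2 < lamc ->
  Fl lamc = a * ln (lamc - 1) -> lam < lamc -> 0 < eps ->
  (fun n : nat => piN lam a n.*2 (dev_event (fun=> a) eps n.*2)) @ \oo --> (0 : R).
Proof.
move=> a0 a2 l0 c2 ec llc eps0.
pose lam' := Num.max lam ((2 + lamc) / 2).
have l2' : 2 < lam' by rewrite lt_max; apply/orP; right; lra.
have lc' : lam' < lamc by rewrite gt_max llc; lra.
have ll' : lam <= lam' by rewrite le_max lexx.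
have l1' : 1 < lam' by lra. have l0' : 0 < lam' by lra.
pose kap := 2 * (a * ln (lam' - 1) - Fl lam').
have kap0 : 0 < kap by have := Fl_subcritical l2' ec lc'; rewrite /kap; lra.
pose u := Num.min (eps / 2) a.
have u0 : 0 < u by rewrite lt_min a0 andbT; lra.
have ua : u <= a by rewrite ge_min lexx orbT.
have ue : u <= eps / 2 by rewrite ge_min lexx.
pose t := Num.min (1 / 2) (u / 4).
have t0 : 0 < t by rewrite lt_min; apply/andP; split; lra.
have t2 : t <= 1 / 2 by rewrite ge_min lexx.
have tu : 4 * t <= u.
  have : t <= u / 4 by rewrite ge_min lexx orbT.
  lra.
have tu0 : 0 < t * u by rewrite mulr_gt0.
have [D1 D10 hD1] := poly_mul_exp_le 4 kap0.
have [D2 D20 hD2] := poly_mul_exp_le 2 tu0.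
have [k hk] := ex_nat_ge (8 / eps).
have [k' hk'] := ex_nat_ge (16 * D2).
apply: (@cvg0_of_bound _ _ (48 * lam' * D1 + 16 * D2) 0 (k' + k + 1)) => n nbig.
rewrite mul0r addr0.
have [kn' _ n1 kN] := large_index nbig.
have N0 : (0 < n.*2)%N by rewrite double_gt0.
have N0' : 0 < n.*2%:R :> R by rewrite ltr0n.
have [h [hE evh h1 h2]] := @evceil_nat R a n.*2 (ltW a0).
have h0 : (0 < h)%N by rewrite -(ltr0n R); apply: lt_le_trans h1; rewrite mulr_gt0.
rewrite /piN hE.
set w := fun s : n.*2.-tuple bool => lam ^+ Hzeros n.*2 (eta_of h s).
have w0 s : 0 <= w s by rewrite exprn_ge0 // ltW.
set num := (X in X / _); set Z := (X in _ / X).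
pose dev s := [exists x : 'I_n.*2.+1, (u * n.*2%:R <= `|(eta_of h s x)%:~R - h%:R|)%R].
pose e := expR (- (t * u * n%:R)); pose e' := expR (- (kap * n%:R)).
have devs := free_any_deviation n h t0 t2 tu; rewrite -/e in devs.
have small : 16 * (n.+1%:R ^+ 2 * e) <= 1.
  have := hD2 n; rewrite -/e ler_pdivlMr ?ltr0n // => hh.
  have nk : 16 * D2 <= n.+1%:R by apply: le_trans hk' _; rewrite ler_nat leqW.
  have n1' : 0 < n.+1%:R :> R by rewrite ltr0n.
  rewrite -(ler_pM2r n1') mul1r; lra.
have touched := @touched_weight_le R lam' h n (fun _ _ => true) 1 l1' h0 ler01.
have {}touched : \sum_(s : n.*2.-tuple bool | in_S n.*2 h s && touches n.*2 h s) w s <=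
    4 ^+ n * (12 * lam' * (n.+1%:R ^+ 3 * e')).
  apply: le_trans (_ : _ <= (lam' ^+ 2 / (lam' - 1)) ^+ n *
    ((n.*2.+1 * n.*2.+1 * (h + n.*2).+1)%:R * (rho lam' h * 1))) _.
    apply: le_trans (touched _ _) => //; last first.
      by move=> x y n2 _ _ _; rewrite mulr_ile1 ?kern_ge0 ?kern_le1.
    rewrite [leRHS](eq_bigl (fun s : n.*2.-tuple bool => in_S n.*2 h s && touches n.*2 h s)).
      by apply: ler_sum => s _; rewrite lerXn2r ?nnegrE // ltW.
    by move=> s; rewrite [X in _ && X](_ : _ = true) ?andbT //; apply/existsP; exists ord0.
  have gr := growth_le l2' h0 h1; rewrite -/kap -/e' in gr.
  have h3 : h%:R <= n%:R + 2 :> R.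
    move: h2; rewrite -addnn natrD => h2.
    have := ler_wpM2r (ler0n R n) (ltW a2); lra.
  rewrite mulr1 mulrCA [leRHS](_ : _ = 12 * n.+1%:R ^+ 3 * (4 ^+ n * (lam' * e'))); last by ring.
  have r0 : 0 <= (lam' ^+ 2 / (lam' - 1)) ^+ n * rho lam' h.
    by rewrite mulr_ge0 ?exprn_ge0 ?divr_ge0 ?exprn_ge0 ?(ltW (rho_gt0 _ _)) //; lra.
  exact: ler_pM (cube_count_le h3) gr.
have num_le : num <= 4 ^+ n * (12 * lam' * (n.+1%:R ^+ 3 * e') + 4 * (n.+1%:R * e)).
  rewrite mulrDr; apply: le_trans (lerD touched devs).
  apply: le_trans (_ : _ <= \sum_(s : n.*2.-tuple bool | in_S n.*2 h s && touches n.*2 h s) w s +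
    \sum_(s : n.*2.-tuple bool | (in_S n.*2 h s && ~~ touches n.*2 h s) && dev s) w s) _.
    apply: sum_le_cover => // s /andP[inS /asboolP dv]; rewrite inS /=.
    case: (touches _ _ _) => //=.
    have [] // := dev_event_grid _ _ N0 dv.
    - by move=> x y; rewrite subrr normr0.
    - by move=> j; exact: eta_of_lipschitz.
    move=> x devx; apply/existsP; exists x.
    have big : 8 <= eps * n.*2%:R.
      have : 8 / eps <= n.*2%:R by apply: le_trans hk _; rewrite ler_nat.
      by rewrite ler_pdivrMr // mulrC.
    have uN : u * n.*2%:R <= eps / 2 * n.*2%:R by rewrite ler_wpM2r.
    move: devx; rewrite !ler_normr => /orP[dd|dd]; apply/orP; [left|right]; lra.
  rewrite lerD2l (@bsum_mkcond _ _ (fun s => (in_S n.*2 h s && ~~ touches n.*2 h s) && dev s)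
    (fun s => lam ^+ Hzeros n.*2 (eta_of h s))).
  apply: le_bsum => s _; rewrite -/(dev s); have [/andP[/andP[_ nt] ->]|_] := boolP (_ && dev s).
    by rewrite untouched_Hzeros // mulr1.
  by rewrite mul0r ler0n.
have Z_ge : 4 ^+ n / (4 * n.+1%:R) <= Z.
  have := subcritical_partition_ge l0 n1 ua h1; rewrite -/Z => /(le_trans _); apply.
  have cb : 4 ^+ n <= n.*2.+1%:R * 'C(n.*2, n)%:R :> R.
    by rewrite -natrX -natrM ler_nat central_bin_ge.
  have v0 : 0 < n.+1%:R :> R by rewrite ltr0n.
  have q0 : 0 < 4 ^+ n :> R by rewrite exprn_gt0.
  have nv : n.*2.+1%:R * 'C(n.*2, n)%:R <= 2 * n.+1%:R * 'C(n.*2, n)%:R :> R.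
    by rewrite ler_wpM2r // -natrM ler_nat mul2n doubleS ltnW //.
  rewrite ler_pdivrMr ?mulr_gt0 //.
  have := ler_wpM2r (ltW v0) devs; have := ler_wpM2l (ltW q0) small.
  lra.
have num0 : 0 <= num by apply: sumr_ge0 => s _; exact: w0.
have Q0 : 0 < 4 ^+ n / (4 * n.+1%:R) :> R by rewrite divr_gt0 ?mulr_gt0 ?exprn_gt0 ?ltr0n.
have Z0 : 0 < Z by apply: lt_le_trans Z_ge.
apply/andP; split; first by rewrite divr_ge0 // ltW.
apply: (@le_trans _ _ (num / (4 ^+ n / (4 * n.+1%:R)))).
  by rewrite ler_wpM2l // lef_pV2 ?posrE.
rewrite ler_pdivrMr //; apply: le_trans num_le _.
have v0 : 0 < n.+1%:R :> R by rewrite ltr0n.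
have q0 : 0 < 4 ^+ n / (4 * n.+1%:R) :> R by [].
have b1 : 48 * lam' * (n.+1%:R ^+ 4 * e') <= 48 * lam' * (D1 / n.+1%:R).
  by rewrite ler_wpM2l ?hD1 // mulr_ge0 // ltW.
have b2 : 16 * (n.+1%:R ^+ 2 * e) <= 16 * (D2 / n.+1%:R) by rewrite ler_wpM2l ?hD2.
have := ler_wpM2l (ltW q0) (lerD b1 b2).
rewrite [X in _ <= X -> _](_ : _ = (48 * lam' * D1 + 16 * D2) / n.+1%:R * (4 ^+ n / (4 * n.+1%:R)));
  last by ring.
apply: le_trans; rewrite le_eqVlt; apply/orP; left; apply/eqP.
by move: (n.+1%:R : R) v0 => v v0; field; rewrite lt0r_neq0.
Qed.

End PhaseTransition.

(* lamc is lambda_c(a): the unique solution in (2,oo) of F(l) = a log(l-1) *)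
Theorem theorem2p2 (R : realType) (a lam lamc : R) :
  0 < a -> a < 1 / 2 -> 0 < lam ->
  2 < lamc -> Fl lamc = a * ln (lamc - 1) ->
  (lamc <= lam -> forall eps : R, 0 < eps ->
     (fun n : nat => piN lam a n.*2 (dev_event (f_al a lam) eps n.*2)) @ \oo --> (0 : R))
  /\
  (lam < lamc -> forall eps : R, 0 < eps ->
     (fun n : nat => piN lam a n.*2 (dev_event (fun _ => a) eps n.*2)) @ \oo --> (0 : R)).
Proof.
move=> a0 a2 l0 c2 ec; split=> [cl|lc] eps eps0; last exact: subcritical ec lc eps0.
apply: supercritical => //; first exact: lt_le_trans cl.
exact: Fl_supercritical ec cl.
Qed.
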